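(* Let $\ell_1,\ell_2,\ell_3,\ell_4,m_1,m_2,m_3,m_4$ be eight generic oriented circles on the two-sphere such that the five Lie quadrilaterals $(\ell_1,\ell_2,m_1,m_2)$, $(\ell_1,\ell_2,m_3,m_4)$, $(\ell_3,\ell_4,m_1,m_2)$, $(\ell_3,\ell_4,m_3,m_4)$, $(\ell_2,\ell_3,m_2,m_3)$ are circumscribed. Then so is the Lie quadrilateral $(\ell_1,\ell_4,m_1,m_4)$.
   Context: Let $\langle x,y\rangle = x_1y_1+x_2y_2+x_3y_3-x_4y_4-x_5y_5$ on $\mathbb{R}^5$. The Lie quadric is $\mathcal{L}=\{[x]\in\mathbb{R}\mathrm{P}^4 : \langle x,x\rangle=0\}$. Oriented circles on $\mathbb{S}^2$ (center $c\in\mathbb{S}^2$, signed spherical radius $r\in\mathbb{R}$) are in bijection with points of $\mathcal{L}$ via $(c,r)\mapsto[c,\cos r,\sin r]$, and are identified with these points. A Lie quadrilateral is a quadruple of oriented circles. It is called circumscribed if the four corresponding points of $\mathcal{L}$ are coplanar, i.e. lie in a common two-dimensional projective subspace of $\mathbb{R}\mathrm{P}^4$. Regarding ''generic'': a sufficient genericity condition for the eight points on the Lie quadric is that no five of them are coplanar.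
   Formalization: ''Generic'' is taken to mean that no five of the eight points are coplanar and that the pairs (ℓ1,ℓ2), (ℓ3,ℓ4), (m1,m2), (m3,m4) are not all four in oriented contact; without the second condition the claim fails. *)

(* Defs.v *)
From HB Require Import structures.
From mathcomp Require Import all_boot all_order all_algebra.
From mathcomp Require Import reals trigo.

Set Implicit Arguments.
Unset Strict Implicit.
Unset Printing Implicit Defensive.

Import Order.TTheory GRing.Theory Num.Theory.

Local Open Scope ring_scope.

Definition lie_form (R : realType) (x y : 'rV[R]_5) : R :=
  \sum_(i < 5) (if (i < 3)%N then 1 else - 1) * x 0 i * y 0 i.

(* Points of RP^4 are the one-dimensional subspaces of R^5; two-dimensional
   projective subspaces are the three-dimensional linear subspaces. *)
Definition lie_quadric (R : realType) (p : {vspace 'rV[R]_5}) : Prop :=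
  \dim p = 1%N /\ forall x, x \in p -> lie_form x x = 0.

(* The norm is spelled out because `|c| on row vectors is the sup norm.
   The pairs (c, r), (c, r + 2 pi) and (- c, r + pi) are the same oriented
   circle; every predicate below depends only on [lie_point]. *)
Record oriented_circle (R : realType) := OrientedCircle {
  center : 'rV[R]_3;
  radius : R;
  center_sphere : \sum_(i < 3) center 0 i ^+ 2 = 1
}.

Definition lie_vector (R : realType) (C : oriented_circle R) : 'rV[R]_5 :=
  row_mx (center C)
    (\row_(j < 2) (if j == 0 then cos (radius C) else sin (radius C))).

Definition lie_point (R : realType) (C : oriented_circle R) :
  {vspace 'rV[R]_5} := <[lie_vector C]>%VS.

Definition coplanar (R : realType) (s : seq {vspace 'rV[R]_5}) : Prop :=
  exists2 P : {vspace 'rV[R]_5},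
    \dim P = 3%N & forall p, p \in s -> (p <= P)%VS.

Definition circumscribed (R : realType) (C1 C2 C3 C4 : oriented_circle R) :
  Prop :=
  coplanar [:: lie_point C1; lie_point C2; lie_point C3; lie_point C4].

(* [subseq] selects positions, so a repeated point counts with multiplicity. *)
Definition no_five_coplanar (R : realType) (s : seq {vspace 'rV[R]_5}) :
  Prop :=
  forall t, subseq t s -> size t = 5%N -> ~ coplanar t.

(* <x, y> = c . c' - cos (r - r') vanishes iff the circles touch with matching
   orientations (or coincide), iff the projective line through the two points
   is contained in the Lie quadric (or the points coincide). *)
Definition oriented_contact (R : realType) (C D : oriented_circle R) : Prop :=
  lie_form (lie_vector C) (lie_vector D) = 0.

(* Since the Lie quadric contains projective lines, [no_five_coplanar] does not
   by itself make eight circles generic for the incidence theorem: if the four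
   lines l1 l2, m1 m2, l3 l4, m3 m4 form a skew quadrilateral inside the
   quadric, the first four coplanarities hold automatically, and the last
   two are independent of each other. The second clause only excludes the
   configurations in which all four lines lie in the quadric. *)
Definition generic (R : realType)
  (l1 l2 l3 l4 m1 m2 m3 m4 : oriented_circle R) : Prop :=
  no_five_coplanar
    [seq lie_point C | C <- [:: l1; l2; l3; l4; m1; m2; m3; m4]] /\
  ~ [/\ oriented_contact l1 l2, oriented_contact l3 l4,
        oriented_contact m1 m2 & oriented_contact m3 m4].

Lemma lie_vectorl (R : realType) (C : oriented_circle R) (i : 'I_3) :
  lie_vector C 0 (lshift 2 i) = center C 0 i.
Proof. exact: row_mxEl. Qed.

Lemma lie_vectorr (R : realType) (C : oriented_circle R) (j : 'I_2) :
  lie_vector C 0 (rshift 3 j) =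
  if j == 0 then cos (radius C) else sin (radius C).
Proof.
by rewrite [LHS](@row_mxEr _ 1 3 2 (center C) _ 0 j) mxE.
Qed.

Lemma lie_form_split (R : realType) (x y : 'rV[R]_5) :
  lie_form x y = \sum_(i < 3) x 0 (lshift 2 i) * y 0 (lshift 2 i)
    - \sum_(j < 2) x 0 (rshift 3 j) * y 0 (rshift 3 j).
Proof.
rewrite /lie_form (big_split_ord _ (m := 3) (n := 2)) /=; congr (_ + _).
  by apply: eq_bigr => i _; rewrite ltn_ord mul1r.
by rewrite -sumrN; apply: eq_bigr => i _; rewrite mulN1r mulNr.
Qed.

Lemma lie_form_vector (R : realType) (C D : oriented_circle R) :
  lie_form (lie_vector C) (lie_vector D) =
  \sum_(i < 3) center C 0 i * center D 0 i - cos (radius C - radius D).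
Proof.
rewrite lie_form_split; congr (_ - _).
  by apply: eq_bigr => i _; rewrite !lie_vectorl.
by rewrite !big_ord_recl big_ord0 !lie_vectorr /= cosB addr0.
Qed.

Lemma lie_formZ (R : realType) (a : R) (x : 'rV[R]_5) :
  lie_form (a *: x) (a *: x) = a ^+ 2 * lie_form x x.
Proof.
rewrite /lie_form mulr_sumr; apply: eq_bigr => i _.
by rewrite !mxE; case: ifP => _; rewrite ?mulN1r ?mul1r ?mulNr ?mulrN
  expr2 mulrACA.
Qed.

Lemma lie_vector_neq0 (R : realType) (C : oriented_circle R) :
  lie_vector C != 0.
Proof.
apply/eqP => C0; have := center_sphere C; rewrite big1 => [/eqP|i _].
  by rewrite eq_sym oner_eq0.
by rewrite -lie_vectorl C0 mxE expr0n.
Qed.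

Lemma cos_sin_onto (R : realType) (a b : R) :
  a ^+ 2 + b ^+ 2 = 1 -> exists r, cos r = a /\ sin r = b.
Proof.
move=> ab1; have a1 : -1 <= a <= 1.
  by rewrite -ler_norml -(@expr_le1 _ 2) // real_normK ?num_real // -ab1
    lerDl sqr_ge0.
have sE : sin (acos a) = `|b|.
  by rewrite sin_acos // -sqrtr_sqr -ab1 addrC addKr.
have cE : cos (acos a) = a by apply: acosK; rewrite in_itv.
have [b0|b0] := leP 0 b.
  by exists (acos a); rewrite sE ger0_norm.
by exists (- acos a); rewrite cosN sinN sE ltr0_norm // opprK.
Qed.

(* Oriented circles are the points of the Lie quadric. *)
Lemma lie_quadricP (R : realType) (p : {vspace 'rV[R]_5}) :
  lie_quadric p <-> exists C, p = lie_point C.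
Proof.
split=> [[p1 p0]|[C ->]]; last first.
  split=> [|x /vlineP[a ->]]; first by rewrite dim_vline lie_vector_neq0.
  rewrite lie_formZ lie_form_vector subrr cos0.
  under eq_bigr do rewrite -expr2.
  by rewrite center_sphere subrr mulr0.
set v := vpick p; have vp : v \in p by exact: memv_pick.
have v0 : v != 0 by rewrite vpick0 -dimv_eq0 p1.
have pE : p = <[v]>%VS.
  by apply/eqP; rewrite eq_sym eqEdim -memvE vp p1 dim_vline v0.
clearbody v.
pose n := \sum_(i < 3) v 0 (lshift 2 i) ^+ 2.
have nE : n = \sum_(j < 2) v 0 (rshift 3 j) ^+ 2.
  have := p0 _ vp; rewrite lie_form_split => /subr0_eq.
  by under eq_bigr do rewrite -expr2; under [RHS]eq_bigr do rewrite -expr2.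
have n_gt0 : 0 < n.
  rewrite lt_def sumr_ge0 ?andbT => [|i _]; last exact: sqr_ge0.
  apply: contraNneq v0 => n0; apply/eqP/rowP => k; rewrite mxE.
  apply/eqP; rewrite -sqrf_eq0; apply/eqP.
  case: (@splitP 3 2 k) => i kE.
    have -> : k = lshift 2 i by exact: val_inj.
    by apply: (psumr_eq0P _ n0) => // j _; exact: sqr_ge0.
  have -> : k = rshift 3 i by exact: val_inj.
  by move: nE; rewrite n0 => /esym/psumr_eq0P -> // j _; exact: sqr_ge0.
pose s := Num.sqrt n.
have s_neq0 : s^-1 != 0 by rewrite invr_eq0 gt_eqF // sqrtr_gt0.
have s2 : s^-1 ^+ 2 = n^-1 by rewrite exprVn sqr_sqrtr // ltW.
have cS : \sum_(i < 3) (s^-1 *: @lsubmx _ 1 3 2 v) 0 i ^+ 2 = 1.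
  under eq_bigr do rewrite !mxE exprMn s2.
  by rewrite -mulr_sumr mulVf // gt_eqF.
have [|r [cr sr]] := @cos_sin_onto R (s^-1 * v 0 (rshift 3 0))
    (s^-1 * v 0 (rshift 3 1)).
  have -> : 1 = lift ord0 ord0 :> 'I_2 by exact: val_inj.
  rewrite !exprMn s2 -mulrDr; have := nE.
  by rewrite [X in _ = X]big_ord_recl big_ord1 => <-; rewrite mulVf // gt_eqF.
exists (OrientedCircle r cS); rewrite pE /lie_point.
have -> : lie_vector (OrientedCircle r cS) = s^-1 *: v.
  apply/rowP => k; rewrite [RHS]mxE; case: (@splitP 3 2 k) => i kE.
    have -> : k = lshift 2 i by exact: val_inj.
    by rewrite lie_vectorl /= !mxE.
  have -> : k = rshift 3 i by exact: val_inj.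
  rewrite lie_vectorr /= cr sr; case: eqP => [->//|/eqP i0].
  by congr (_ * v _ (rshift 3 _)); apply: val_inj; case: i i0 {kE} => [[|[]]].
apply/eqP; rewrite eq_sym eqEdim !dim_vline scaler_eq0 negb_or s_neq0 v0 andbT.
by rewrite -memvE memvZ // memv_line.
Qed.

(* Main.v *)
(* Consecutive lines in the cycle l1 l2, m1 m2, l3 l4, m3 m4 meet, by the first
   four coplanarities. If the four meeting points are distinct, they are the
   vertices of a skew quadrilateral in a projective 3-space whose sides carry
   the eight points. By Carnot's theorem for the quadric, the product of the
   eight ratios in which the points divide the sides is 1; by Menelaus' theorem,
   four points, one on each side, are coplanar iff the product of their four
   ratios is 1. Hence l2, l3, m2, m3 are coplanar iff l1, l4, m1, m4 are. If two
   of the meeting points coincide, genericity forces the four lines to be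
   concurrent in a point off the quadric, and the reflection in that point
   exchanges l2, l3, m2, m3 with l1, l4, m1, m4. *)
Require Import Defs.
From mathcomp Require Import all_boot all_order all_algebra.
From mathcomp Require Import reals trigo.
From mathcomp Require Import boolp ring.

Set Implicit Arguments.
Unset Strict Implicit.
Unset Printing Implicit Defensive.

Import Order.TTheory GRing.Theory Num.Theory.

Local Open Scope ring_scope.

(** * Linear dependence and dimension *)

Lemma linear_relation (F : fieldType) (V : vectType F) (n : nat)
    (v : 'I_n -> V) (P : {vspace V}) :
    (\dim P < n)%N -> (forall i, v i \in P) ->
  exists2 c : 'I_n -> F, exists i, c i != 0 & \sum_i c i *: v i = 0.
Proof.
move=> dimP vP; pose X := [tuple v i | i < n].
have XE (i : 'I_n) : X`_i = v i by rewrite -tnth_nth tnth_mktuple.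
apply: contrapT => noc.
suff : free X.
  rewrite /free size_tuple => /eqP dimX.
  have /dimvS : (<<X>> <= P)%VS by apply/span_subvP => _ /mapP[i _ ->].
  by rewrite dimX leqNgt dimP.
apply/freeP => c c0 i; apply: contrapT => /eqP ci; apply: noc.
exists c; first by exists i.
by rewrite -[RHS]c0; apply: eq_bigr => j _; rewrite XE.
Qed.

Lemma vspace_between (F : fieldType) (V : vectType F) (U : {vspace V}) k :
    (\dim U <= k <= \dim {:V})%N ->
  exists2 P : {vspace V}, \dim P = k & (U <= P)%VS.
Proof.
elim: k => [|k IHk] /andP[dimU kV].
  by exists U => //; apply/eqP; rewrite -leqn0.
move: dimU; rewrite leq_eqVlt => /predU1P[<-|]; first by exists U.
rewrite ltnS => dimU; have [|P dimP UP] := IHk; first by rewrite dimU ltnW.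
have /subvPn[v _ vP] : ~~ (fullv <= P)%VS.
  by apply/negP => /dimvS; rewrite dimP leqNgt kV.
exists (P + <[v]>)%VS; last exact: subv_trans UP (addvSl _ _).
apply/eqP; rewrite eqn_leq -dimP; apply/andP; split.
  apply: leq_trans (dimv_add_leqif _ _) _.
  by rewrite dim_vline -addn1 leq_add2l; case: (v != 0).
rewrite ltnNge; apply: contra vP => dimPv.
have /eqP -> : P == (P + <[v]>)%VS by rewrite eqEdim addvSl.
by apply: subvP (addvSr _ _) _ _; exact: memv_line.
Qed.

(** Dependent vectors span dimension at most 3; the span is then enlarged, because [coplanar] asks
    for dimension exactly 3. *)
Lemma coplanar_relation (R : realType) (v : 'I_4 -> 'rV[R]_5) (c : 'I_4 -> R) :
    (exists i, c i != 0) -> \sum_i c i *: v i = 0 ->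
  exists2 P : {vspace 'rV[R]_5}, \dim P = 3%N & forall i, v i \in P.
Proof.
move=> [i ci] c0; pose X := [tuple v i | i < 4].
have XE (j : 'I_4) : X`_j = v j by rewrite -tnth_nth tnth_mktuple.
have [|P dimP XP] := @vspace_between R _ <<X>>%VS 3.
  rewrite dimvf /= dim_matrix andbT leqNgt; apply/negP => dimX.
  have /freeP freeX : free X.
    by rewrite /free eqn_leq dim_span size_tuple.
  have : \sum_(i < 4) c i *: X`_i = 0.
    by rewrite -[RHS]c0; apply: eq_bigr => j _; rewrite XE.
  by move/freeX => /(_ i) /eqP; rewrite (negPf ci).
exists P => // j; apply: (subvP XP); apply: memv_span.
by rewrite -XE mem_nth // size_tuple.
Qed.

(** * Indices modulo 4, and the meeting of coplanar lines *)

Lemma ord4_cycle (i : 'I_4) : i + 1 + 1 + 1 + 1 = i.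
Proof. by apply/val_inj; case: i => [[|[|[|[]]]]]. Qed.

Lemma mem_ord4 (i j : 'I_4) : j \in [:: i; i + 1; i + 1 + 1; i + 1 + 1 + 1].
Proof.
by rewrite !inE -!val_eqE; case: i j => [[|[|[|[|i]]]] ?] [[|[|[|[|j]]]] ?].
Qed.

Lemma ord4_propagate (Q : 'I_4 -> Prop) i :
  (forall j, Q j -> Q (j + 1)) -> Q i -> forall j, Q j.
Proof.
move=> QS Qi j.
have := mem_ord4 i j.
by rewrite !inE => /or4P[]/eqP->; rewrite ?Qi //; do !apply: (QS).
Qed.

Lemma sum_ord4_shift (V : zmodType) (f : 'I_4 -> V) :
  \sum_i f (i + 1) = \sum_i f i.
Proof. by rewrite [RHS](reindex_inj (addIr (1 : 'I_4))). Qed.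

(** Two lines in a plane meet. [Q0] and [Q1] each contain one line and miss the given points of the
    other, and [S] separates [p] from [r]; hence all four coefficients of a linear relation are
    nonzero, and the meeting point is none of the given points. *)
Lemma lines_meet (F : fieldType) (V : vectType F)
    (p0 r0 p1 r1 : V) (P Q0 Q1 S : {vspace V}) :
    \dim P = 3%N -> [/\ p0 \in P, r0 \in P, p1 \in P & r1 \in P] ->
    [/\ p0 \in Q0, r0 \in Q0, p1 \notin Q0 & r1 \notin Q0] ->
    [/\ p1 \in Q1, r1 \in Q1, p0 \notin Q1 & r0 \notin Q1] ->
    [/\ r0 \in S, r1 \in S, p0 \notin S & p1 \notin S] ->
    r0 != 0 -> r1 != 0 ->
  exists a a' b b' : F, [/\ a != 0, a' != 0, b != 0, b' != 0
    & a *: p0 + a' *: r0 = b *: p1 + b' *: r1].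
Proof.
move=> dimP [p0P r0P p1P r1P] [p0Q0 r0Q0 p1Q0 r1Q0] [p1Q1 r1Q1 p0Q1 r0Q1].
move=> [r0S r1S p0S p1S] r0n r1n.
have drop (x : F) (u w : V) (T : {vspace V}) :
    u \notin T -> w \in T -> x *: u + w = 0 -> x = 0.
  move=> uT wT /eqP; rewrite addr_eq0 => /eqP xu.
  apply/eqP; apply: contraNT uT => x0.
  by rewrite -[u]scale1r -(mulVf x0) -scalerA xu memvZ // memvN.
have free2 (x y : F) (u w : V) (T : {vspace V}) :
    u \notin T -> w \in T -> w != 0 -> x *: u + y *: w = 0 -> x = 0 /\ y = 0.
  move=> uT wT w0 e; have x0 := drop _ _ _ _ uT (memvZ y wT) e.
  split=> //; move/eqP: e; rewrite x0 scale0r add0r scaler_eq0 (negPf w0).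
  by rewrite orbF => /eqP.
pose v (i : 'I_4) := nth 0 [:: p0; r0; p1; r1] i.
have [||c [k ck]] := @linear_relation F V 4 v P; first by rewrite dimP.
  by case=> [[|[|[|[|i]]]] ?].
rewrite !big_ord_recl big_ord0 addr0 /v /= !addrA.
set x := c _; set y := c _; set z := c _; set w := c _ => rel.
have nz : ~ [/\ x = 0, y = 0, z = 0 & w = 0].
  case=> x0 y0 z0 w0; case/eqP: ck.
  by case: k => [[|[|[|[|k]]]] kP] //;
    [rewrite -x0|rewrite -y0|rewrite -z0|rewrite -w0];
    congr (c _); exact: val_inj.
have z_neq0 : z != 0.
  apply/eqP => z0; apply: nz; move: rel; rewrite z0 scale0r addr0 => rel.
  have w0 : w = 0.
    apply: (drop _ r1 (x *: p0 + y *: r0) _ r1Q0); first by rewrite memvD ?memvZ.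
    by rewrite addrC.
  move: rel; rewrite w0 scale0r addr0 => rel.
  by have [-> ->] := free2 _ _ _ _ _ p0S r0S r0n rel.
have w_neq0 : w != 0.
  apply/eqP => w0; case/eqP: z_neq0; move: rel; rewrite w0 scale0r addr0 => rel.
  apply: (drop _ p1 (x *: p0 + y *: r0) _ p1Q0); first by rewrite memvD ?memvZ.
  by rewrite addrC.
have zw : z *: p1 + w *: r1 \in Q1 by rewrite memvD ?memvZ.
have x_neq0 : x != 0.
  apply/eqP => x0; move: rel; rewrite x0 scale0r add0r -addrA => rel.
  have y0 := drop _ _ _ _ r0Q1 zw rel.
  move: rel; rewrite y0 scale0r add0r => /(free2 _ _ _ _ _ p1S r1S r1n)[z0 _].
  by case/eqP: z_neq0.
have y_neq0 : y != 0.
  apply/eqP => y0; case/eqP: x_neq0; move: rel.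
  by rewrite y0 scale0r addr0 -addrA => /(drop _ _ _ _ p0Q1 zw).
exists x, y, (- z), (- w); split; rewrite ?oppr_eq0 //.
by apply/eqP; rewrite -subr_eq0 !scaleNr opprD !opprK addrA rel.
Qed.

(** * Symmetric bilinear forms and the incidence theorem for four lines *)

Definition sym_bilinear (F : fieldType) (V : lmodType F) (q : V -> V -> F) :=
  (forall u v, q u v = q v u) /\ (forall w, scalar (q w)).

Section Bilinear.
Context (F : fieldType) (V : lmodType F) (q : V -> V -> F).
Context (qb : sym_bilinear q).

Lemma bilinearDr u v w : q w (u + v) = q w u + q w v.
Proof. by have := qb.2 w 1 u v; rewrite scale1r mul1r. Qed.

Lemma bilinear0r w : q w 0 = 0.
Proof.
by apply/eqP; rewrite -(inj_eq (addrI (q w 0))) -bilinearDr !addr0.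
Qed.

Lemma bilinearZr a u w : q w (a *: u) = a * q w u.
Proof. by have := qb.2 w a u 0; rewrite !addr0 bilinear0r addr0. Qed.

Lemma bilinear_sumr (I : finType) (a : I -> F) (u : I -> V) w :
  q w (\sum_i a i *: u i) = \sum_i a i * q w (u i).
Proof.
apply: (big_ind2 (fun u x => q w u = x)); first exact: bilinear0r.
  by move=> u1 x1 u2 x2 <- <-; exact: bilinearDr.
by move=> i _; exact: bilinearZr.
Qed.

Lemma isotropic_comb a b u v : q u u = 0 -> q v v = 0 ->
  q (a *: u + b *: v) (a *: u + b *: v) = 2%:R * (a * b * q u v).
Proof.
move=> u0 v0; rewrite bilinearDr !bilinearZr ![q (_ + _) _]qb.1.
by rewrite !bilinearDr !bilinearZr u0 v0 [q v u]qb.1; ring.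
Qed.

End Bilinear.

(* The reflection in the common point [A] of the four lines exchanges [p i]
   and [r i] up to scalars, and so carries a linear relation between the [r i]
   to one between the [p i]. *)
Lemma concurrent_relation (F : fieldType) (V : lmodType F) (q : V -> V -> F)
    (p r : 'I_4 -> V) (A : V) (x y c : 'I_4 -> F) :
    sym_bilinear q -> 2%:R != 0 :> F ->
    (forall i, q (p i) (p i) = 0) -> (forall i, q (r i) (r i) = 0) ->
    (forall i, A = x i *: p i + y i *: r i) ->
    (forall i, x i != 0) -> (forall i, y i != 0) -> q A A != 0 ->
    \sum_i c i *: r i = 0 -> (exists i, c i != 0) ->
  exists2 e : 'I_4 -> F, exists i, e i != 0 & \sum_i e i *: p i = 0.
Proof.
move=> qb two pp rr AE x0 y0 qA rel [k ck].
(* These coefficients come from substituting [r i = (A - x i p i) / y i] in the relation; the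
   multiple of [A] has to vanish. *)
exists (fun i => c i / y i * x i).
  by exists k; rewrite !mulf_neq0 ?invr_neq0.
(* Pair the relation with [A]: isotropy gives [q A (r i) = q A A / (2 y i)], and [q A A] is
   nonzero. *)
have sumc : \sum_i c i / y i = 0.
  have := bilinear0r qb A; rewrite -rel (bilinear_sumr qb).
  have -> : \sum_i c i * q A (r i) = \sum_i c i / y i * (q A A / 2%:R).
    apply: eq_bigr => i _; rewrite {2 3}(AE i) (isotropic_comb qb) //.
    rewrite (AE i) qb.1 (bilinearDr qb) !(bilinearZr qb) rr [q (r i) _]qb.1.
    by field; rewrite two y0.
  rewrite -mulr_suml => /eqP; rewrite mulf_eq0 mulf_eq0 (negPf qA) invr_eq0.
  by rewrite (negPf two) !orbF => /eqP.
transitivity ((\sum_i c i / y i) *: A - \sum_i c i *: r i).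
  rewrite scaler_suml -sumrB; apply: eq_bigr => i _.
  by rewrite (AE i) scalerDr !scalerA (mulfVK (y0 i)) addrK.
by rewrite sumc rel scale0r subr0.
Qed.

(* [A i] is the common point of the lines [i] and [i + 1] of a skew
   quadrilateral. The equality of products [a i * a' i * s i = b i * b' i *
   s (i + 1)], multiplied around the quadrilateral, is Carnot's theorem for the
   quadric and the eight points on the sides; a linear relation between four of
   these points, one on each side, is Menelaus' theorem. *)
Lemma skew_relation (F : fieldType) (V : lmodType F) (p r A : 'I_4 -> V)
    (a a' b b' s c : 'I_4 -> F) :
    (forall i, A i = a i *: p i + a' i *: r i) ->
    (forall i, A i = b i *: p (i + 1) + b' i *: r (i + 1)) ->
    (forall i, [/\ a i != 0, a' i != 0, b i != 0 & s i != 0]) ->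
    (forall i, a i * a' i * s i = b i * b' i * s (i + 1)) ->
    (forall i, a (i + 1) * b' i - a' (i + 1) * b i != 0) ->
    (forall f, \sum_i f i *: A i = 0 -> forall i, f i = 0) ->
    \sum_i c i *: r i = 0 -> (exists i, c i != 0) ->
  exists2 e : 'I_4 -> F, exists i, e i != 0 & \sum_i e i *: p i = 0.
Proof.
move=> AE AE' n0 sE D0 freeA rel [k ck].
pose D i := a (i + 1) * b' i - a' (i + 1) * b i.
have {}D0 i : D i != 0 := D0 i.
(* Cramer's rule: [D i] is the determinant of [A (i + 1)] and [A i] in terms of [p (i + 1)] and
   [r (i + 1)]. *)
have DpE i : D i *: p (i + 1) = b' i *: A (i + 1) - a' (i + 1) *: A i.
  rewrite (AE (i + 1)) (AE' i) !scalerDr !scalerA opprD addrACA -!scalerBl.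
  rewrite [X in _ + X *: _](_ : _ = 0) ?scale0r ?addr0; last by ring.
  by congr (_ *: _); rewrite /D; ring.
have DrE i : D i *: r (i + 1) = a (i + 1) *: A i - b i *: A (i + 1).
  rewrite (AE (i + 1)) (AE' i) !scalerDr !scalerA opprD addrACA -!scalerBl.
  rewrite [X in X *: _ + _](_ : _ = 0) ?scale0r ?add0r; last by ring.
  by congr (_ *: _); rewrite /D; ring.
pose d i := c (i + 1) / D i.
(* The difference of the two sides is the coefficient of [A (i + 1)] in the relation between the
   [r i], rewritten by [DrE]. *)
have dE i : d (i + 1) * a (i + 1 + 1) = d i * b i.
  apply/eqP; rewrite -subr_eq0; apply/eqP; move: i.
  pose f i := d i * a (i + 1); pose g i := d i * b i.
  have fg : \sum_i (f (i + 1) - g i) *: A (i + 1) = 0.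
    rewrite -[RHS]rel -[RHS]sum_ord4_shift.
    under eq_bigr do rewrite scalerBl.
    rewrite sumrB (sum_ord4_shift (fun i => f i *: A i)) -sumrB.
    apply: eq_bigr => i _; have := DrE i => /(congr1 (fun u => d i *: u)).
    by rewrite scalerBr !scalerA /d divfK // => ->.
  have shift4 i : i + 1 + 1 + 1 + 1 = i := ord4_cycle i.
  pose h i := f i - g (i + 1 + 1 + 1).
  move=> i; have := freeA h _ (i + 1).
  rewrite /h shift4; apply.
  rewrite -sum_ord4_shift -[RHS]fg; apply: eq_bigr => j _.
  by rewrite /h shift4.
(* One nonzero [c k] suffices: by [dE], nonvanishing passes from [d j] to [d (j + 1)]. *)
have d0 i : d i != 0.
  have dS j : d j != 0 -> d (j + 1) != 0.
    move=> dj; have [_ _ bj _] := n0 j.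
    by have := mulf_neq0 dj bj; rewrite -dE mulf_eq0 negb_or => /andP[].
  apply: (@ord4_propagate (fun j => d j != 0) (k + 1 + 1 + 1) dS).
  by rewrite /d ord4_cycle mulf_neq0 ?invr_neq0 ?D0.
clearbody d.
(* A closed form solving the recurrence [eE], by [dE] and [sE]. Being a function of the cyclic
   index, it closes up around the quadrilateral with no product of ratios to compute. *)
pose e i := (d i * a (i + 1) * a' (i + 1) * a i * a' i * s i)^-1.
have eE i : e (i + 1) * a' (i + 1 + 1) = e i * b' i.
  have [ai a'i bi si] := n0 i; have [ai1 a'i1 bi1 si1] := n0 (i + 1).
  have [ai2 a'i2 _ _] := n0 (i + 1 + 1).
  have b'E : b' i = a i * a' i * s i / (b i * s (i + 1)).
    by rewrite sE; field; rewrite bi si1.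
  have bE : b i = d (i + 1) * a (i + 1 + 1) / d i.
    by rewrite dE; field; exact: d0.
  rewrite b'E bE /e; field.
  by rewrite ?ai ?a'i ?si ?ai1 ?a'i1 ?si1 ?ai2 ?a'i2 ?(d0 i) ?(d0 (i + 1)).
pose eD i := e i * D i.
(* The coefficient of [p (i + 1)] is [eD i], and [i + 1 + 1 + 1] is the predecessor of [i]. *)
exists (fun i => eD (i + 1 + 1 + 1)).
  exists (k + 1); rewrite /eD ord4_cycle mulf_neq0 ?D0 // invr_neq0 //.
  have [ak a'k _ sk] := n0 k; have [ak1 a'k1 _ _] := n0 (k + 1).
  by rewrite !mulf_neq0 ?d0.
rewrite -sum_ord4_shift.
transitivity (\sum_i (e i * b' i) *: A (i + 1)
  - \sum_i (e i * a' (i + 1)) *: A i).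
  rewrite -sumrB; apply: eq_bigr => i _.
  by rewrite ord4_cycle -(scalerA (e i) (D i)) DpE scalerBr !scalerA.
rewrite -(sum_ord4_shift (fun i => (e i * a' (i + 1)) *: A i)).
by rewrite -sumrB big1 // => i _; rewrite eE subrr.
Qed.

(* Cyclically along the four lines, [p] is [l1, m1, l4, m4], [r] is
   [l2, m2, l3, m3], and the plane [P i] contains the lines [i] and [i + 1]. *)
Lemma cyclic_incidence (F : fieldType) (V : vectType F) (q : V -> V -> F)
    (p r : 'I_4 -> V) (P : 'I_4 -> {vspace V}) (S : {vspace V}) :
    sym_bilinear q -> 2%:R != 0 :> F ->
    (forall i, q (p i) (p i) = 0) -> (forall i, q (r i) (r i) = 0) ->
    (forall i, r i != 0) ->
    (forall i, \dim (P i) = 3%N) ->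
    (forall i, p i \in P i /\ r i \in P i) ->
    (forall i, p (i + 1) \in P i /\ r (i + 1) \in P i) ->
    (forall i, p (i + 1 + 1) \notin P i /\ r (i + 1 + 1) \notin P i) ->
    (forall i, p (i + 1 + 1 + 1) \notin P i /\ r (i + 1 + 1 + 1) \notin P i) ->
    \dim S = 3%N -> (forall i, r i \in S) -> (forall i, p i \notin S) ->
    (exists i, q (p i) (r i) != 0) ->
  exists2 e : 'I_4 -> F, exists i, e i != 0 & \sum_i e i *: p i = 0.
Proof.
move=> qb two pp rr r0 dimP P0 P1 P2 P3 dimS rS pS [k sk].
have [||c c0 rel] := @linear_relation F V 4 r S; rewrite ?dimS //.
have : forall i, exists a a' b b' : F,
    [/\ a != 0, a' != 0, b != 0, b' != 0
      & a *: p i + a' *: r i = b *: p (i + 1) + b' *: r (i + 1)].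
  move=> i; have [p0 r0'] := P0 i; have [p1 r1] := P1 i.
  have [p0' r0''] := P1 (i + 1 + 1 + 1); have [p2 r2] := P2 (i + 1 + 1 + 1).
  have [p3 r3] := P0 (i + 1); have [p4 r4] := P3 (i + 1).
  rewrite ord4_cycle in p0' r0'' p2 r2 p4 r4.
  (* The plane before [P i] contains line [i] but misses the points of line [i + 1]; the plane after
     it does the opposite. *)
  by apply: (@lines_meet F V (p i) (r i) (p (i + 1)) (r (i + 1))
    (P i) (P (i + 1 + 1 + 1)) (P (i + 1)) S).
move=> /fin_all_exists[a] /fin_all_exists[a'] /fin_all_exists[b].
move=> /fin_all_exists[b'] abE.
pose A i := a i *: p i + a' i *: r i.
have AE i : A i = b i *: p (i + 1) + b' i *: r (i + 1) by have [] := abE i.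
pose s i := q (p i) (r i).
have qA i : q (A i) (A i) = 2%:R * (a i * a' i * s i).
  exact: (isotropic_comb qb).
(* Both sides are half of [q (A i) (A i)], computed on the two lines through [A i]. *)
have sE i : a i * a' i * s i = b i * b' i * s (i + 1).
  by apply: (mulfI two); rewrite -qA AE (isotropic_comb qb).
have s0 i : s i != 0.
  apply: (ord4_propagate (Q := fun i => s i != 0)) sk i => j sj.
  have [aj a'j _ _ _] := abE j.
  have := mulf_neq0 (mulf_neq0 aj a'j) sj.
  by rewrite sE mulf_eq0 negb_or => /andP[].
have AP i : A i \in P i by have [? ?] := P0 i; rewrite memvD ?memvZ.
have AP0 i : A i \in P (i + 1).
  by have [? ?] := P0 (i + 1); rewrite AE memvD ?memvZ.
have AP1 i : A (i + 1) \in P i by have [? ?] := P1 i; rewrite memvD ?memvZ.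
pose D i := a (i + 1) * b' i - a' (i + 1) * b i.
have DpE i : D i *: p (i + 1) = b' i *: A (i + 1) - a' (i + 1) *: A i.
  rewrite (AE i) [A (i + 1)]/A !scalerDr !scalerA opprD addrACA -!scalerBl.
  rewrite [X in _ + X *: _](_ : _ = 0) ?scale0r ?addr0; last by ring.
  by congr (_ *: _); rewrite /D; ring.
have pP i (T : {vspace V}) : D i != 0 -> A i \in T -> A (i + 1) \in T ->
    p (i + 1) \in T.
  move=> Di A0 A1; rewrite -[p _]scale1r -(mulVf Di) -scalerA DpE.
  by rewrite memvZ // memvB // memvZ.
have DAE i : D i = 0 -> a (i + 1) *: A i = b i *: A (i + 1).
  move=> D0; rewrite AE /A !scalerDr !scalerA [b i * a _]mulrC; congr (_ + _ *: _).
  by apply/eqP; rewrite -subr_eq0 [b i * _]mulrC -/(D i) D0.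
have [/existsP[m /eqP Dm]|/existsPn D0] := boolP [exists i, D i == 0].
  (* One coincidence forces all: if [A j] and [A (j + 1)] agree up to scalars but [D (j + 1)] is
     nonzero, then [P (j + 1 + 1 + 1)] contains [A (j + 1)] and [A (j + 1 + 1)], hence
     [p (j + 1 + 1)]. *)
  have {Dm} D0 i : D i = 0.
    apply: (ord4_propagate (Q := fun i => D i = 0)) Dm i => j Dj.
    apply/eqP; apply: contraT => /pP Dj1.
    have [/negP[]] := P3 (j + 1 + 1 + 1).
    rewrite ord4_cycle; apply: Dj1; last exact: AP0.
    have [aj1 _ _ _ _] := abE (j + 1); have [_ _ bj _ _] := abE j.
    rewrite -[A _]scale1r -(mulVf bj) -scalerA -DAE // !memvZ //.
    by rewrite -{1}[j]ord4_cycle AP1.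
  have : forall i, exists t, t != 0 /\ A k = t *: A i.
    apply: (@ord4_propagate _ k) => [j [t [t0 ->]]|]; last first.
      by exists 1; rewrite oner_eq0 scale1r.
    have [aj1 _ _ _ _] := abE (j + 1); have [_ _ bj _ _] := abE j.
    exists (t / a (j + 1) * b j); rewrite !mulf_neq0 ?invr_neq0 //; split=> //.
    by rewrite -scalerA -DAE // scalerA divfK.
  move=> /fin_all_exists[t tE].
  apply: (@concurrent_relation F V q p r (A k) (fun i => t i * a i)
    (fun i => t i * a' i) c) => // [i|i|i|].
  - by have [_ ->] := tE i; rewrite scalerDr !scalerA.
  - by have [ti _] := tE i; have [ai _ _ _ _] := abE i; rewrite mulf_neq0.
  - by have [ti _] := tE i; have [_ ai _ _ _] := abE i; rewrite mulf_neq0.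
  by have [ak a'k _ _ _] := abE k; rewrite qA !mulf_neq0.
apply: (@skew_relation F V p r A a a' b b' s c) => //.
  by move=> i; have [? ? ? _ _] := abE i.
(* The other three [A j] lie in [P (i + 1 + 1)]. If [f i] were nonzero, so would [A i], and then
   also [p i], on the line from [A (i + 1 + 1 + 1)] to [A i]. *)
move=> f fA i; apply/eqP; apply: contraT => fi.
have [/negP[]] := P2 (i + 1 + 1).
rewrite ord4_cycle -[X in p X]ord4_cycle; apply: pP; [exact: D0|exact: AP1|].
rewrite ord4_cycle -[A i]scale1r -(mulVf fi) -scalerA memvZ //.
move/eqP: fA; rewrite (bigD1 i) //= addr_eq0 => /eqP->; rewrite memvN.
apply: memv_suml => j ji; rewrite memvZ //.
have := mem_ord4 i j.
rewrite !inE (negPf ji) /= => /or3P[]/eqP->; [exact: AP0|exact: AP|exact: AP1].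
Qed.

(** * Oriented circles as isotropic vectors *)

Lemma lie_form_sym_bilinear (R : realType) : sym_bilinear (@lie_form R).
Proof.
split=> [u v|w a u v].
  by apply: eq_bigr => i _; rewrite -!mulrA [u 0 i * _]mulrC.
rewrite /lie_form mulr_sumr -big_split; apply: eq_bigr => i _ /=.
by rewrite !mxE; ring.
Qed.

Lemma lie_vector_isotropic (R : realType) (C : oriented_circle R) :
  lie_form (lie_vector C) (lie_vector C) = 0.
Proof.
have [_ +] := (lie_quadricP (lie_point C)).2 (ex_intro _ C erefl).
by apply; exact: memv_line.
Qed.

Lemma circumscribedP (R : realType) (C1 C2 C3 C4 : oriented_circle R) :
  circumscribed C1 C2 C3 C4 <->
  exists2 P : {vspace 'rV[R]_5}, \dim P = 3%N &
    [/\ lie_vector C1 \in P, lie_vector C2 \in P, lie_vector C3 \in P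
      & lie_vector C4 \in P].
Proof.
split=> -[P dimP CP]; exists P => //.
  by split; rewrite memvE; apply: CP; rewrite !inE eqxx ?orbT.
by move=> _ /[!inE] /or4P[]/eqP->; rewrite -memvE; case: CP.
Qed.

(** In this form, four known members of a plane exclude all the others at once. *)
Lemma no_five_coplanar_count (R : realType) (s : seq 'rV[R]_5)
    (P : {vspace 'rV[R]_5}) :
    no_five_coplanar [seq <[v]>%VS | v <- s] -> \dim P = 3%N ->
  (count (mem P) s <= 4)%N.
Proof.
move=> gen dimP; rewrite leqNgt -size_filter; apply/negP => s5.
apply: (gen [seq <[v]>%VS | v <- take 5 [seq v <- s | v \in P]]).
- by apply/map_subseq/(subseq_trans (take_subseq _ _))/filter_subseq.
- by rewrite size_map size_takel.
exists P => // _ /mapP[v /mem_take + ->].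
by rewrite mem_filter -memvE => /andP[].
Qed.

Theorem theorem8p1 (R : realType)
  (l1 l2 l3 l4 m1 m2 m3 m4 : oriented_circle R)
  (hgen : generic l1 l2 l3 l4 m1 m2 m3 m4)
  (h1212 : circumscribed l1 l2 m1 m2)
  (h1234 : circumscribed l1 l2 m3 m4)
  (h3412 : circumscribed l3 l4 m1 m2)
  (h3434 : circumscribed l3 l4 m3 m4)
  (h2323 : circumscribed l2 l3 m2 m3) :
  circumscribed l1 l4 m1 m4.
Proof.
case: hgen => gen contact.
have {}gen P : \dim P = 3%N -> (count (mem P)
    [seq lie_vector C | C <- [:: l1; l2; l3; l4; m1; m2; m3; m4]] <= 4)%N.
  by apply: no_five_coplanar_count; rewrite -map_comp; exact: gen.
have [P0 dim0 [l10 l20 m10 m20]] := (circumscribedP _ _ _ _).1 h1212.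
have [P1 dim1 [l31 l41 m11 m21]] := (circumscribedP _ _ _ _).1 h3412.
have [P2 dim2 [l32 l42 m32 m42]] := (circumscribedP _ _ _ _).1 h3434.
have [P3 dim3 [l13 l23 m33 m43]] := (circumscribedP _ _ _ _).1 h1234.
have [S dimS [l2S l3S m2S m3S]] := (circumscribedP _ _ _ _).1 h2323.
have [n30 n40 k30 k40] : [/\ lie_vector l3 \notin P0, lie_vector l4 \notin P0,
    lie_vector m3 \notin P0 & lie_vector m4 \notin P0].
  by have := gen _ dim0; rewrite /= l10 l20 m10 m20; do 4![case: (_ \in _)].
have [n11 n21 k31 k41] : [/\ lie_vector l1 \notin P1, lie_vector l2 \notin P1,
    lie_vector m3 \notin P1 & lie_vector m4 \notin P1].
  by have := gen _ dim1; rewrite /= l31 l41 m11 m21; do 4![case: (_ \in _)].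
have [n12 n22 k12 k22] : [/\ lie_vector l1 \notin P2, lie_vector l2 \notin P2,
    lie_vector m1 \notin P2 & lie_vector m2 \notin P2].
  by have := gen _ dim2; rewrite /= l32 l42 m32 m42; do 4![case: (_ \in _)].
have [n33 n43 k13 k23] : [/\ lie_vector l3 \notin P3, lie_vector l4 \notin P3,
    lie_vector m1 \notin P3 & lie_vector m2 \notin P3].
  by have := gen _ dim3; rewrite /= l13 l23 m33 m43; do 4![case: (_ \in _)].
have [n1S n4S k1S k4S] : [/\ lie_vector l1 \notin S, lie_vector l4 \notin S,
    lie_vector m1 \notin S & lie_vector m4 \notin S].
  by have := gen _ dimS; rewrite /= l2S l3S m2S m3S; do 4![case: (_ \in _)].
pose p (i : 'I_4) := lie_vector (nth l1 [:: l1; m1; l4; m4] i).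
pose r (i : 'I_4) := lie_vector (nth l1 [:: l2; m2; l3; m3] i).
pose P (i : 'I_4) := nth P0 [:: P0; P1; P2; P3] i.
have [||||||||||e e0 rel] := @cyclic_incidence R _ (@lie_form R) p r P S
    (lie_form_sym_bilinear R) _ (fun i => lie_vector_isotropic _)
    (fun i => lie_vector_isotropic _) (fun i => lie_vector_neq0 _).
- by rewrite pnatr_eq0.
- by case=> [[|[|[|[|i]]]] ?].
- by case=> [[|[|[|[|i]]]] ?].
- by case=> [[|[|[|[|i]]]] ?].
- by case=> [[|[|[|[|i]]]] ?].
- by case=> [[|[|[|[|i]]]] ?].
- exact: dimS.
- by case=> [[|[|[|[|i]]]] ?].
- by case=> [[|[|[|[|i]]]] ?].
(* Otherwise all four lines lie in the quadric, which [generic] excludes; symmetry is used where [p]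
   and [r] list a pair in reverse order. *)
- have [/existsP//|/existsPn s0] := boolP [exists i, lie_form (p i) (r i) != 0].
  have {}s0 i : lie_form (p i) (r i) = 0 by apply/eqP; move: (s0 i); case: eqP.
  case: contact; split; rewrite /oriented_contact.
  + exact: (s0 (@Ordinal 4 0 isT)).
  + by rewrite (lie_form_sym_bilinear R).1; exact: (s0 (@Ordinal 4 2 isT)).
  + exact: (s0 (@Ordinal 4 1 isT)).
  + by rewrite (lie_form_sym_bilinear R).1; exact: (s0 (@Ordinal 4 3 isT)).
have [T dimT pT] := coplanar_relation e0 rel.
apply/circumscribedP; exists T => //; split.
- exact: (pT (@Ordinal 4 0 isT)).
- exact: (pT (@Ordinal 4 2 isT)).
- exact: (pT (@Ordinal 4 1 isT)).
- exact: (pT (@Ordinal 4 3 isT)).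
Qed.
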